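(* Let $d\geq 1$, $T\in GL_d(k)$ and $v_{i,j,l}\in V_d$ for $1\leq i<j<l\leq 3d$. Then $$det^{S^3}(\otimes_{1\leq i<j<l\leq 3d}(T(v_{i,j,l})))=\det(T)^{\binom{3d-1}{2}}\cdot det^{S^3}(\otimes_{1\leq i<j<l\leq 3d}(v_{i,j,l})).$$ In particular, $det^{S^3}:V_d^{\otimes\binom{3d}{3}}\to k$ is invariant under the action of $SL_d(k)$.
   Context: $k$ is a field of characteristic zero, $\otimes=\otimes_k$, and $V_d$ is a $k$-vector space of dimension $d$ with basis $\{e_1,\dots,e_d\}$. The group $GL_d(k)$ acts on $V_d$ via this basis, and on $V_d^{\otimes\binom{3d}{3}}$ by $T\ast(\otimes_{1\leq i<j<l\leq 3d}(v_{i,j,l}))=\otimes_{1\leq i<j<l\leq 3d}(T(v_{i,j,l}))$. Definition of $det^{S^3}$. Given $v_{i,j,l}\in V_d$ for $1\leq i<j<l\leq 3d$, for each $1\leq m<n\leq 3d$ let $\mathcal{E}_{m,n}$ be the vector equation (with scalar unknowns $\lambda_{i,j,l}$) $$\sum_{r=1}^{m-1}(-1)^{r-1}\lambda_{r,m,n}v_{r,m,n}+\sum_{s=m+1}^{n-1}(-1)^s\lambda_{m,s,n}v_{m,s,n}+\sum_{t=n+1}^{3d}(-1)^{t+1}\lambda_{m,n,t}v_{m,n,t}=0.$$ In the basis $e_1,\dots,e_d$ each $\mathcal{E}_{m,n}$ is a block of $d$ scalar linear equations. Let $A_{3d}((v_{i,j,l}))$ be the $d\binom{3d-1}{2}\times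 d\binom{3d-1}{2}$ coefficient matrix of the system of the equations $\mathcal{E}_{m,n}$ with $1\leq m<n<3d$ (columns indexed by triples, row blocks by pairs, in lexicographic order). Then $det^{S^3}:V_d^{\otimes\binom{3d}{3}}\to k$ is the linear map with $det^{S^3}(\otimes_{1\leq i<j<l\leq 3d}(v_{i,j,l}))=\det(A_{3d}((v_{i,j,l})))$. *)

(* Defs.v *)
From HB Require Import structures.
From mathcomp Require Import all_boot all_order all_algebra.

Set Implicit Arguments.
Unset Strict Implicit.
Unset Printing Implicit Defensive.

Import Order.TTheory GRing.Theory.
Local Open Scope ring_scope.

(* The tensor power V^{(x) I} of a finite-dimensional space V is modelled by   *)
(* its coordinates on the pure tensors of vectors of the canonical basis       *)
(* [vbasis fullv] of V; [tlift_pure] and [tlift_unique] below prove that it    *)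
(* has the universal property of the tensor power.                             *)
Definition tpow (k : fieldType) (V : vectType k) (I : finType) :=
  {ffun {ffun I -> 'I_(\dim {:V})} -> k^o}.

(* Locked because comparing two instances up to conversion diverges.           *)
HB.lock Definition subst (V : Type) (I : finType) (v : {ffun I -> V}) (i : I)
    (x : V) : {ffun I -> V} :=
  [ffun j => if j == i then x else v j].
Canonical subst_unlockable := Unlockable subst.unlock.

Lemma substE (V : Type) (I : finType) (v : {ffun I -> V}) i x j :
  subst v i x j = if j == i then x else v j.
Proof. by rewrite unlock ffunE. Qed.

Section TensorPower.
Variables (k : fieldType) (V : vectType k) (I : finType).

Notation b := (vbasis {:V}).

Definition tpure (v : {ffun I -> V}) : tpow V I :=
  [ffun f : {ffun I -> 'I_(\dim {:V})} => \prod_i coord b (f i) (v i)].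

Definition multilinear (U : lmodType k) (F : {ffun I -> V} -> U) : Prop :=
  forall v i a x y,
    F (subst v i (a *: x + y)) = a *: F (subst v i x) + F (subst v i y).

(* The linear map tpow V I -> U induced by a multilinear F.                    *)
Definition tlift (U : lmodType k) (F : {ffun I -> V} -> U) (t : tpow V I) : U :=
  \sum_(f : {ffun I -> 'I_(\dim {:V})}) t f *: F [ffun i => b`_(f i)].

Lemma tlift_linear (U : lmodType k) (F : {ffun I -> V} -> U) : linear (tlift F).
Proof.
move=> a s t; rewrite /tlift scaler_sumr -big_split; apply: eq_bigr => f _ /=.
by rewrite !ffunE scalerDl scalerA.
Qed.

Lemma tpureE v f : tpure v f = \prod_i coord b (f i) (v i).
Proof. by rewrite /tpure ffunE. Qed.

Lemma tpow_linE a (s t : tpow V I) f : (a *: s + t) f = a * s f + t f.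
Proof. by rewrite ffunE [(a *: s) f]ffunE. Qed.

Lemma tpure_multilinear : multilinear tpure.
Proof.
move=> v i a x y; apply/ffunP=> f; rewrite tpow_linE !tpureE.
rewrite !(bigD1 i (P := xpredT)) //= !substE eqxx linearP /=.
have E z : \prod_(j | j != i) coord b (f j) (subst v i z j)
           = \prod_(j | j != i) coord b (f j) (v j).
  by apply: eq_bigr => j /negPf ji; rewrite substE ji.
by rewrite !E mulrDl -mulrA.
Qed.

Lemma multilinear_sum (U : lmodType k) (F : {ffun I -> V} -> U) v i
    (J : Type) (r : seq J) (c : J -> k) (w : J -> V) : multilinear F ->
  F (subst v i (\sum_(j <- r) c j *: w j))
  = \sum_(j <- r) c j *: F (subst v i (w j)).
Proof.
move=> Fl; have F0 : F (subst v i 0) = 0.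
  have := Fl v i (-1) 0 0; rewrite scaler0 addr0 scaleN1r addNr; exact.
by elim: r => [|j r IH]; rewrite ?big_nil // !big_cons Fl IH.
Qed.

Lemma multilinear_ext (U : lmodType k) (F G : {ffun I -> V} -> U) :
  multilinear F -> multilinear G ->
  (forall f : {ffun I -> 'I_(\dim {:V})},
      F [ffun i => b`_(f i)] = G [ffun i => b`_(f i)]) ->
  F =1 G.
Proof.
move=> Fl Gl FG v.
suff H (s : seq I) (u : {ffun I -> V}) :
    (forall i, i \notin s -> exists j : 'I_(\dim {:V}), u i = b`_j) ->
    F u = G u.
  by apply: (H (enum I)) => i; rewrite mem_enum.
elim: s u => [|i s IH] u Hu.
  have /fin_all_exists [f Hf] : forall i, exists j : 'I_(\dim {:V}), u i = b`_j.
    by move=> i; apply: Hu.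
  suff -> : u = [ffun i => b`_([ffun i => f i] i)] by apply: FG.
  by apply/ffunP=> i; rewrite !ffunE Hf.
have -> : u = subst u i (\sum_j coord b j (u i) *: b`_j).
  apply/ffunP=> j; rewrite substE; case: eqP => // ->.
  by rewrite -coord_vbasis ?memvf.
rewrite !multilinear_sum //; apply: eq_bigr => j _; congr (_ *: _).
apply: IH => l ls; rewrite substE; case: eqP => [_|/eqP li]; first by exists j.
by apply: Hu; rewrite inE negb_or li.
Qed.

Lemma tlift_pure (U : lmodType k) (F : {ffun I -> V} -> U) :
  multilinear F -> forall v, tlift F (tpure v) = F v.
Proof.
move=> Fl; apply: multilinear_ext => //.
  by move=> v i a x y; rewrite tpure_multilinear tlift_linear.
move=> f; rewrite /tlift (bigD1 f) //= ffunE.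
have bfree : free b by apply: basis_free (vbasisP _).
rewrite big1 ?scale1r => [|i _]; last by rewrite ffunE coord_free // eqxx.
rewrite big1 ?addr0 // => g gf.
have [i fgi] : exists i, g i != f i.
  apply/existsP; apply: contraNT gf => /existsPn H.
  by apply/eqP/ffunP=> i; move: (H i); rewrite negbK => /eqP.
rewrite ffunE (bigD1 i) //= ffunE coord_free //.
by rewrite eq_sym (negPf fgi) mul0r scale0r.
Qed.

Lemma tlift_unique (U : lmodType k) (L M : tpow V I -> U) :
  linear L -> linear M -> (forall v, L (tpure v) = M (tpure v)) -> L =1 M.
Proof.
suff H (N : tpow V I -> U) : linear N -> N =1 tlift (N \o tpure).
  move=> Ll Ml LM t; rewrite (H L) // (H M) //.
  by apply: eq_bigr => f _ /=; rewrite LM.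
move=> Nl t; have N0 : N 0 = 0.
  have := Nl (-1) 0 0; rewrite scaler0 addr0 scaleN1r addNr; exact.
have Ns (r : seq {ffun I -> 'I_(\dim {:V})}) (T : _ -> tpow V I) :
    N (\sum_(f <- r) t f *: T f) = \sum_(f <- r) t f *: N (T f).
  by elim: r => [|f r IH]; rewrite ?big_nil // !big_cons Nl IH.
rewrite /tlift /= -Ns; congr (N _); apply/ffunP=> f.
have bfree : free b by apply: basis_free (vbasisP _).
rewrite sum_ffunE (bigD1 f) //= !ffunE big1 => [|i _]; last first.
  by rewrite ffunE coord_free // eqxx.
rewrite big1 => [|g gf]; first by rewrite addr0 /GRing.scale /= mulr1.
have [i fgi] : exists i, g i != f i.
  apply/existsP; apply: contraNT gf => /existsPn H.
  by apply/eqP/ffunP=> i; move: (H i); rewrite negbK => /eqP.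
rewrite !ffunE (bigD1 i) //= ffunE coord_free //.
by rewrite (negPf fgi) mul0r /GRing.scale /= mulr0.
Qed.

End TensorPower.

(* Pairs m < n and triples i < j < l of indices, counted from 0: the paper's   *)
(* index i is i.+1 here.                                                       *)
Record pair (n : nat) :=
  Pair { pval : 'I_n * 'I_n; _ : (pval.1 < pval.2)%N }.
Record triple (n : nat) :=
  Triple { trval : 'I_n * 'I_n * 'I_n; _ : (trval.1.1 < trval.1.2 < trval.2)%N }.

HB.instance Definition _ n := [isSub for @pval n].
HB.instance Definition _ n := [Finite of pair n by <:].
HB.instance Definition _ n := [isSub for @trval n].
HB.instance Definition _ n := [Finite of triple n by <:].

Definition tr1 n (t : triple n) : 'I_n := (val t).1.1.
Definition tr2 n (t : triple n) : 'I_n := (val t).1.2.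
Definition tr3 n (t : triple n) : 'I_n := (val t).2.

Lemma card_pair n : #|{: pair n}| = 'C(n, 2).
Proof.
rewrite card_sub -(card_ltn_sorted_tuples 2 n).
pose f (p : 'I_n * 'I_n) : 2.-tuple 'I_n := [tuple p.1; p.2].
have fI : injective f by case=> a c [a' c'] [] -> ->.
rewrite -(card_image fI); apply: eq_card => t; rewrite inE.
apply/imageP/idP => [[p]|].
  by rewrite inE => ? ->; rewrite /= andbT.
case/tupleP: t => a t; case/tupleP: t => c t; rewrite tuple0 /= andbT => ac.
by exists (a, c) => //; apply: val_inj.
Qed.

Lemma card_triple n : #|{: triple n}| = 'C(n, 3).
Proof.
rewrite card_sub -(card_ltn_sorted_tuples 3 n).
pose f (p : 'I_n * 'I_n * 'I_n) : 3.-tuple 'I_n := [tuple p.1.1; p.1.2; p.2].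
have fI : injective f by move=> [[a c] g] [[a' c'] g'] [] -> -> ->.
rewrite -(card_image fI); apply: eq_card => t; rewrite inE.
apply/imageP/idP => [[p]|].
  by rewrite inE => ? ->; rewrite /= andbT.
case/tupleP: t => a t; case/tupleP: t => c t; case/tupleP: t => g t.
rewrite tuple0 /= andbT => ac.
by exists (a, c, g) => //; apply: val_inj.
Qed.

Section Lexicographic.

Definition lex (A B : eqType) (r : rel A) (s : rel B) : rel (A * B) :=
  fun x y => r x.1 y.1 || (x.1 == y.1) && s x.2 y.2.

Definition ord_ltn n : rel 'I_n := fun i j => (i < j)%N.

Lemma pairwise_enum_ord n : pairwise (@ord_ltn n) (enum 'I_n).
Proof.
rewrite -[pairwise _ _](pairwise_map val ltn) val_enum_ord.
by rewrite -(sorted_pairwise ltn_trans) iota_ltn_sorted.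
Qed.

Lemma pairwise_enum_prod (A B : finType) (r : rel A) (s : rel B) :
  pairwise r (enum A) -> pairwise s (enum B) ->
  pairwise (lex r s) (enum {: A * B}).
Proof.
move=> rA sB; rewrite enumT unlock /= /prod_enum.
elim: (enum A) rA => //= a u IH /andP[au /IH{}IH].
rewrite pairwise_cat IH andbT; apply/andP; split.
  apply/allrelP => x y /mapP[c _ ->] /allpairsP[[a' c'] /= [a'u _ ->]].
  by rewrite /lex /= (allP au).
rewrite pairwise_map; apply: sub_pairwise sB => c c' sc.
by rewrite /lex /= eqxx sc orbT.
Qed.

Lemma pairwise_enum_pair n :
  pairwise (relpre val (lex (@ord_ltn n) (@ord_ltn n))) (enum {: pair n}).
Proof.
rewrite -pairwise_map enumT unlock /= (pmap_filter (@insubK _ _ _)).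
apply: pairwise_filter; rewrite -enumT.
by apply: pairwise_enum_prod; apply: pairwise_enum_ord.
Qed.

(* [enum] lists pairs, triples and rows in lexicographic order.                *)
Lemma enum_triple_lex n :
  pairwise (relpre val (lex (lex (@ord_ltn n) (@ord_ltn n)) (@ord_ltn n)))
    (enum {: triple n}).
Proof.
rewrite -pairwise_map enumT unlock /= (pmap_filter (@insubK _ _ _)).
apply: pairwise_filter; rewrite -enumT.
by do 2?apply: pairwise_enum_prod; apply: pairwise_enum_ord.
Qed.

Lemma enum_row_lex n d :
  pairwise (lex (relpre val (lex (@ord_ltn n) (@ord_ltn n))) (@ord_ltn d))
    (enum {: pair n * 'I_d}).
Proof.
apply: pairwise_enum_prod; last exact: pairwise_enum_ord.
exact: pairwise_enum_pair.
Qed.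

End Lexicographic.

Lemma size_rows d :
  (d * 'C((3 * d).-1, 2) = #|{: pair (3 * d).-1 * 'I_d}|)%N.
Proof. by rewrite card_prod card_pair card_ord mulnC. Qed.

Lemma size_columns d : (d * 'C((3 * d).-1, 2) = #|{: triple (3 * d)}|)%N.
Proof.
rewrite card_triple; apply/eqP; rewrite -(eqn_pmul2l (isT : 0 < 3)%N) mulnA.
by rewrite mul_bin_diag.
Qed.

(* The pair and coordinate of row p, and the triple of column q, of A_{3d}.    *)
Definition row_index d (p : 'I_(d * 'C((3 * d).-1, 2))) :
    pair (3 * d).-1 * 'I_d := enum_val (cast_ord (size_rows d) p).

Definition column_index d (q : 'I_(d * 'C((3 * d).-1, 2))) : triple (3 * d) :=
  enum_val (cast_ord (size_columns d) q).

Lemma det_col_linear (R : comNzRingType) n (A B C : 'M[R]_n) (q0 : 'I_n) a :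
    (forall p, A p q0 = a * B p q0 + C p q0) ->
    (forall q p, q != q0 -> B p q = A p q) ->
    (forall q p, q != q0 -> C p q = A p q) ->
  \det A = a * \det B + \det C.
Proof.
move=> Hq HB HC; rewrite -(det_tr A) -(det_tr B) -(det_tr C).
rewrite -[\det C^T]mul1r; apply: (@determinant_multilinear _ _ _ _ _ q0).
- by apply/rowP=> p; rewrite !mxE Hq mul1r.
- by apply/matrixP=> q p; rewrite !mxE HB // eq_sym neq_lift.
- by apply/matrixP=> q p; rewrite !mxE HC // eq_sym neq_lift.
Qed.

(* Left-hand side of the equation E_{m,n}. With indices counted from 0, the    *)
(* signs (-1)^(r-1), (-1)^s, (-1)^(t+1) become (-1)^r, (-1)^(s+1), (-1)^t.     *)
Definition eq_lhs (k : fieldType) (V : vectType k) N (v : {ffun triple N -> V})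
    (lam : triple N -> k) (m n : nat) : V :=
  \sum_(x : triple N | (tr2 x == m :> nat) && (tr3 x == n :> nat))
     ((-1) ^+ tr1 x * lam x) *: v x
  + \sum_(x : triple N | (tr1 x == m :> nat) && (tr3 x == n :> nat))
     ((-1) ^+ (tr2 x).+1 * lam x) *: v x
  + \sum_(x : triple N | (tr1 x == m :> nat) && (tr2 x == n :> nat))
     ((-1) ^+ tr3 x * lam x) *: v x.

(* Row (m,n), c and column x: the coefficient of the unknown lam x in the c-th *)
(* coordinate of E_{m,n}. The paper's bound n < 3d is n < 3d - 1 from 0.       *)
Definition A3d (k : fieldType) d (V : vectType k) (e : d.-tuple V)
    (v : {ffun triple (3 * d) -> V}) :
    'M[k]_(d * 'C((3 * d).-1, 2)) :=
  \matrix_(p, q)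
    coord e (row_index p).2
      (eq_lhs v (fun y => (y == column_index q)%:R)
         (val (row_index p).1).1 (val (row_index p).1).2).

Section DetS3.
Variables (k : fieldType) (d : nat) (V : vectType k) (e : d.-tuple V).

Definition detS3 : tpow V (triple (3 * d)) -> k :=
  tlift (fun v => \det (A3d e v) : k^o).

Definition gl_act (T : 'M[k]_d) (x : V) : V :=
  \sum_(j < d) coord e j x *: \sum_(i < d) T i j *: e`_i.

Definition tens_act (T : 'M[k]_d) :
    tpow V (triple (3 * d)) -> tpow V (triple (3 * d)) :=
  tlift (fun v => tpure [ffun x => gl_act T (v x)]).

Definition eq_coef N (x : triple N) (m n : nat) : k :=
  ((tr2 x == m :> nat) && (tr3 x == n :> nat))%:R * (-1) ^+ tr1 x
  + ((tr1 x == m :> nat) && (tr3 x == n :> nat))%:R * (-1) ^+ (tr2 x).+1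
  + ((tr1 x == m :> nat) && (tr2 x == n :> nat))%:R * (-1) ^+ tr3 x.

Lemma eq_lhs_unit N (v : {ffun triple N -> V}) x m n :
  eq_lhs v (fun y => (y == x)%:R) m n = eq_coef x m n *: v x.
Proof.
have E (P : pred (triple N)) (c : triple N -> k) :
    \sum_(y | P y) (c y * (y == x)%:R) *: v y = ((P x)%:R * c x) *: v x.
  rewrite big_mkcond (bigD1 x) //= big1 => [|y /negPf yx].
    by rewrite eqxx addr0; case: (P x); rewrite ?mulr1 ?mul1r ?mul0r ?scale0r.
  by rewrite yx mulr0 scale0r if_same.
by rewrite /eq_lhs !E -!scalerDl.
Qed.

Lemma A3dE v p q :
  A3d e v p q = eq_coef (column_index q)
                (val (row_index p).1).1 (val (row_index p).1).2
              * coord e (row_index p).2 (v (column_index q)).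
Proof. by rewrite mxE eq_lhs_unit linearZ. Qed.

Lemma det_A3d_multilinear :
  multilinear (fun v : {ffun triple (3 * d) -> V} => \det (A3d e v) : k^o).
Proof.
move=> v x a y z.
pose q0 := cast_ord (esym (size_columns d)) (enum_rank x).
have q0E : column_index q0 = x.
  by rewrite /column_index /q0 cast_ordKV enum_rankK.
have qE q : q != q0 -> column_index q == x = false.
  move=> qq0; apply: contraNF qq0 => /eqP H; apply/eqP.
  apply: (@cast_ord_inj _ _ (size_columns d)).
  by apply: enum_val_inj; rewrite -[LHS]/(column_index q) H -q0E.
change (\det (A3d e (subst v x (a *: y + z)))
  = a * \det (A3d e (subst v x y)) + \det (A3d e (subst v x z))).
apply: (@det_col_linear k _ _ _ _ q0) => [p|q p qq0|q p qq0].
- by rewrite 3!A3dE q0E 3!substE eqxx linearP mulrDr mulrCA.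
- by rewrite 2!A3dE 2!substE (qE _ qq0).
- by rewrite 2!A3dE 2!substE (qE _ qq0).
Qed.

Lemma detS3_pure v : detS3 (tpure v) = \det (A3d e v).
Proof. exact: (tlift_pure det_A3d_multilinear). Qed.

Lemma tens_act_pure T v :
  tens_act T (tpure v) = tpure [ffun x => gl_act T (v x)].
Proof.
rewrite /tens_act tlift_pure // => {}v x a y z.
have lin_T : gl_act T (a *: y + z) = a *: gl_act T y + gl_act T z.
  rewrite /gl_act scaler_sumr -big_split; apply: eq_bigr => j _ /=.
  by rewrite linearP scalerDl scalerA.
have E w : [ffun t => gl_act T (subst v x w t)]
         = subst [ffun t => gl_act T (v t)] x (gl_act T w).
  by apply/ffunP=> t; rewrite substE 2!ffunE substE; case: eqP.
by rewrite !E lin_T tpure_multilinear.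
Qed.

End DetS3.

(* Main.v *)
(* Left multiplication by T on every vector multiplies the coefficient matrix  *)
(* on the left by the Kronecker product of the identity indexed by the pairs   *)
(* m < n with T, whose determinant is det T to the number of pairs.            *)
Require Import Defs.
From HB Require Import structures.
From mathcomp Require Import all_boot all_order all_fingroup all_algebra.

Set Implicit Arguments.
Unset Strict Implicit.
Unset Printing Implicit Defensive.

Import Order.TTheory GRing.Theory.
Local Open Scope ring_scope.

(** In each equation the scalar coefficient of a vector is the same for all of its coordinates, so
    applying [T] to every vector multiplies each block of [d] rows by [T] ([A3d_gl_act]). The rows
    consist of one such block per pair, so the block-diagonal factor has determinant a power of
    [\det T] ([det_kron1]), and counting pairs gives the exponent. Invariance when [\det T = 1] then
    passes from pure tensors to all tensors by linearity. *)

(** Two enumerations of [X] differ by a permutation, which acts on rows and columns at once, so its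
    sign occurs squared. Determinants may thus be computed in any convenient order of the
    indices. *)
Lemma det_reindex (R : comNzRingType) (X : eqType) (F : X -> X -> R) m n
    (g : 'I_m -> X) (h : 'I_n -> X) :
  bijective g -> bijective h ->
  \det (\matrix_(i, j) F (g i) (g j)) = \det (\matrix_(i, j) F (h i) (h j)).
Proof.
move=> [g' gK g'K] [h' hK h'K].
have gh_bij : bijective (g' \o h) by exists (h' \o g) => i /=; rewrite ?g'K ?h'K.
have mn : n = m by have := bij_eq_card gh_bij; rewrite !card_ord.
case: _ / mn g g' gK g'K gh_bij => g g' gK g'K /bij_inj gh_inj.
pose s := perm gh_inj.
have -> : \matrix_(i, j) F (h i) (h j)
          = row_perm s (col_perm s (\matrix_(i, j) F (g i) (g j))).
  by apply/matrixP=> i j; rewrite !mxE !permE /= !g'K.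
rewrite row_permE col_permE !det_mulmx !det_perm odd_permV mulrCA -expr2.
by rewrite sqrr_sign mulr1.
Qed.

(** Induction on [N], splitting off one diagonal block [T]. The enumeration [g] is arbitrary so that
    it can be exchanged for one adapted to this splitting. *)
Lemma det_kron1_ord (R : comNzRingType) d (T : 'M[R]_d) N n
    (g : 'I_n -> 'I_N * 'I_d) : bijective g ->
  \det (\matrix_(i, j) (((g i).1 == (g j).1)%:R * T (g i).2 (g j).2))
  = \det T ^+ N.
Proof.
elim: N n g => [|N IH] n g g_bij.
  have n0 : n = 0%N.
    by have := bij_eq_card g_bij; rewrite card_prod !card_ord mul0n.
  by case: _ / (esym n0) g g_bij => g _; rewrite det_mx00 expr0.
pose g1 : 'I_#|{: 'I_N * 'I_d}| -> 'I_N * 'I_d := enum_val.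
(* Listing the indices with first component [ord0] before all others makes the matrix block
   diagonal. *)
pose h (i : 'I_(d + #|{: 'I_N * 'I_d}|)) : 'I_N.+1 * 'I_d :=
  match split i with
  | inl c => (ord0, c)
  | inr q => (lift ord0 (g1 q).1, (g1 q).2)
  end.
have h_bij : bijective h.
  apply: inj_card_bij; last by rewrite card_prod !card_ord card_prod !card_ord mulSn.
  move=> i j; rewrite /h -{2}(splitK i) -{2}(splitK j).
  case: (split i) => a; case: (split j) => b //=.
  - by case=> ->.
  - move=> E; congr (rshift _ _); apply: enum_val_inj.
    have /= E1 := lift_inj (congr1 fst E); have /= E2 := congr1 snd E.
    by rewrite -/(g1 a) -/(g1 b); case: (g1 a) (g1 b) E1 E2 => a1 a2 [b1 b2] /= -> ->.
pose F (x y : 'I_N.+1 * 'I_d) : R := (x.1 == y.1)%:R * T x.2 y.2.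
rewrite (det_reindex F g_bij h_bij) exprS -(IH _ g1 (enum_val_bij _)).
rewrite -(det_ublock _ 0); congr (\det _); apply/matrixP=> i j.
rewrite -(splitK i) -(splitK j) mxE /F /h !unsplitK.
case: (split i) => a; case: (split j) => b /=.
- by rewrite block_mxEul mul1r.
- by rewrite block_mxEur mxE mul0r.
- by rewrite block_mxEdl mxE mul0r.
- by rewrite block_mxEdr mxE.
Qed.

Lemma det_kron1 (R : comNzRingType) d (T : 'M[R]_d) (P : finType) n
    (g : 'I_n -> P * 'I_d) : bijective g ->
  \det (\matrix_(i, j) (((g i).1 == (g j).1)%:R * T (g i).2 (g j).2))
  = \det T ^+ #|P|.
Proof.
move=> g_bij; pose f (x : P * 'I_d) := (enum_rank x.1, x.2).
have f_bij : bijective f.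
  by exists (fun x => (enum_val x.1, x.2)) => -[a b];
     rewrite /f /= ?enum_rankK ?enum_valK.
rewrite -(det_kron1_ord T (bij_comp f_bij g_bij)); congr (\det _).
by apply/matrixP=> i j; rewrite !mxE /= (inj_eq enum_rank_inj).
Qed.

Lemma row_index_bij d : bijective (@row_index d).
Proof.
apply: bij_comp (enum_val_bij _) _.
by exists (cast_ord (esym (size_rows d))) => i; rewrite (cast_ordK, cast_ordKV).
Qed.

Section GeneralLinearAction.
Variables (k : fieldType) (d : nat) (V : vectType k) (e : d.-tuple V).
Hypothesis e_free : free e.

Lemma coord_gl_act (T : 'M[k]_d) x i :
  coord e i (gl_act e T x) = \sum_j T i j * coord e j x.
Proof.
rewrite linear_sum; apply: eq_bigr => j _; rewrite linearZ /= mulrC.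
by rewrite coord_sum_free.
Qed.

(** [eq_coef] depends on the pair and the triple but not on the coordinate, so it commutes with the
    action of [T] on coordinates. *)
Lemma A3d_gl_act (T : 'M[k]_d) (v : {ffun triple (3 * d) -> V}) :
  A3d e [ffun x => gl_act e T (v x)]
  = \matrix_(p, q) (((row_index p).1 == (row_index q).1)%:R
                     * T (row_index p).2 (row_index q).2) *m A3d e v.
Proof.
apply/matrixP=> p q; rewrite A3dE ffunE coord_gl_act mulr_sumr mxE.
pose F (x : pair (3 * d).-1 * 'I_d) : k :=
  ((row_index p).1 == x.1)%:R * T (row_index p).2 x.2
  * (eq_coef k (column_index q) (val x.1).1 (val x.1).2
     * coord e x.2 (v (column_index q))).
under [RHS]eq_bigr => r _ do rewrite mxE A3dE -/(F (row_index r)).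
have [h hK h'K] := row_index_bij d.
rewrite -(reindex (@row_index d) (P := xpredT) (F := F)); last by exists h => r _.
(* The sum over rows becomes a double sum over pairs and coordinates, in which only the pair of row
   [p] contributes. *)
rewrite (eq_bigr (fun x => F (x.1, x.2))); last by case.
rewrite -(pair_bigA _ (fun a c => F (a, c))) /=.
rewrite (bigD1 (row_index p).1) //= [X in _ + X]big1 ?addr0 => [|a /negPf ap].
  by apply: eq_bigr => j _; rewrite /F /= eqxx mul1r mulrCA.
by apply: big1 => j _; rewrite /F /= eq_sym ap !mul0r.
Qed.

Lemma detS3_gl_act (T : 'M[k]_d) (v : {ffun triple (3 * d) -> V}) :
  detS3 e (tpure [ffun x => gl_act e T (v x)])
  = \det T ^+ 'C((3 * d).-1, 2) * detS3 e (tpure v).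
Proof.
rewrite !detS3_pure A3d_gl_act det_mulmx.
by rewrite (det_kron1 T (row_index_bij d)) card_pair.
Qed.

End GeneralLinearAction.

Theorem proposition3p10 (k : fieldType) (k_char0 : [pchar k] =i pred0)
    (d : nat) (d_ge1 : (1 <= d)%N)
    (V : vectType k) (e : d.-tuple V) (e_basis : basis_of {:V} e) :
  (forall (T : 'M[k]_d) (v : {ffun triple (3 * d) -> V}),
      T \in unitmx ->
      detS3 e (tpure [ffun x => gl_act e T (v x)])
      = \det T ^+ 'C((3 * d).-1, 2) * detS3 e (tpure v))
  /\
  (forall (T : 'M[k]_d) (t : tpow V (triple (3 * d))),
      \det T = 1 -> detS3 e (tens_act e T t) = detS3 e t).
Proof.
have e_free := basis_free e_basis.
split=> [T v _|T t detT1]; first exact: detS3_gl_act.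
(* Both sides are linear in [t], so the universal property reduces the claim to pure tensors. *)
apply: (tlift_unique (L := fun t => detS3 e (tens_act e T t) : k^o)
                     (M := fun t => detS3 e t : k^o)) => [a x y|a x y|v].
- by rewrite /tens_act tlift_linear /detS3 tlift_linear.
- by rewrite /detS3 tlift_linear.
- by rewrite tens_act_pure detS3_gl_act // detT1 expr1n mul1r.
Qed.
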